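(* Suppose there exist $c_1, c_2 > 0$ such that, for all $n \ge 1$, all Gaussian vectors $X = (X_i)_{1 \le i \le n}$ (with covariance kernel $K(i,j) = \mathrm{Cov}[X_i,X_j]$), all $I_1, I_2 \subseteq \{1,\ldots,n\}$, all increasing events $A_1 \in \sigma(I_1)$ and $A_2 \in \sigma(I_2)$, and all $\varepsilon > 0$, $$\mathbb{P}[X \in A_1 \cap A_2] - \mathbb{P}[X + \varepsilon \in A_1]\,\mathbb{P}[X + \varepsilon \in A_2] \le c_1 e^{-c_2 \varepsilon^2 / \|K_{I_1,I_2}\|_\infty}.$$ Then $c_2 \le \frac{1}{3 - 2\sqrt{2}}$.
   Context: For a real number $a$, $X + a$ denotes $X + a\mathbf{1}$, where $\mathbf{1}$ is the vector of ones. $\|K_{I_1,I_2}\|_\infty = \max_{i \in I_1, j \in I_2} |K(i,j)|$; when this is $0$ the right-hand side is read as $0$. An event $A$ is a Borel subset of $\mathbb{R}^n$. It is increasing if $x \in A$ implies $x + v \in A$ for every $v \in \mathbb{R}^n$ with $v \ge 0$ coordinatewise. It is supported on $I \subseteq \{1,\ldots,n\}$, written $A \in \sigma(I)$, if for every $v \in \mathbb{R}^n$ with $v|_I = 0$ one has $x \in A$ if and only if $x + v \in A$. Gaussian vectors may be degenerate. *)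

(* Defs.v *)
From HB Require Import structures.
From mathcomp Require Import all_boot all_order all_algebra.
From mathcomp Require Import all_classical all_reals all_analysis.

Set Implicit Arguments.
Unset Strict Implicit.
Unset Printing Implicit Defensive.

Import Order.TTheory GRing.Theory Num.Theory.
Import numFieldNormedType.Exports.

Local Open Scope classical_set_scope.
Local Open Scope ring_scope.

(* The case s = 0 is a point mass at m; it has to be treated apart because the
   library sets normal_prob m 0 to be the uniform law on [0, 1]. *)
Definition gaussian_law (R : realType) (m s : R) : set R -> \bar R :=
  if s == 0 then \d_m else normal_prob m s.

(* Every linear combination of the coordinates is Gaussian, with point masses
   allowed, so X need be neither centred nor nondegenerate. *)
Definition gaussian_vector (R : realType) (n : nat) (d : measure_display)
    (T : measurableType d) (P : probability T R) (X : 'I_n -> {RV P >-> R}) :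
    Prop :=
  forall a : 'I_n -> R, exists m s : R, 0 <= s /\
    forall B : set R, measurable B ->
      P [set w | B (\sum_(i < n) a i * X i w)] = gaussian_law m s B.

Definition random_vector (R : realType) (n : nat) (d : measure_display)
    (T : measurableType d) (P : probability T R) (X : 'I_n -> {RV P >-> R})
    (w : T) : 'rV[R]_n :=
  \row_(i < n) X i w.

Definition cov_kernel (R : realType) (n : nat) (d : measure_display)
    (T : measurableType d) (P : probability T R) (X : 'I_n -> {RV P >-> R})
    (i j : 'I_n) : R :=
  fine (covariance P (X i) (X j)).

Definition sup_norm_on (R : realType) (n : nat) (K : 'I_n -> 'I_n -> R)
    (I1 I2 : {set 'I_n}) : R :=
  \big[Num.max/0]_(i in I1) \big[Num.max/0]_(j in I2) `|K i j|.

Definition borel_event (R : realType) (n : nat) (A : set 'rV[R]_n) : Prop :=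
  <<s @open 'rV[R]_n >> A.

Definition increasing_event (R : realType) (n : nat) (A : set 'rV[R]_n) :
    Prop :=
  forall x v : 'rV[R]_n, A x -> (forall i, 0 <= v 0 i) -> A (x + v).

Definition supported_on (R : realType) (n : nat) (I : {set 'I_n})
    (A : set 'rV[R]_n) : Prop :=
  forall v : 'rV[R]_n, (forall i, i \in I -> v 0 i = 0) ->
    forall x : 'rV[R]_n, A x <-> A (x + v).

(* The value 0 at k = 0 is the limit as k -> 0+; it is set apart because x / 0
   is 0, which would make the exponential equal to 1. *)
Definition sprinkling_bound (R : realType) (c1 c2 eps k : R) : R :=
  if k == 0 then 0 else c1 * expR (- (c2 * eps ^+ 2 / k)).

(* Main.v *)
From HB Require Import structures.
Require Import Defs.
From mathcomp Require Import all_boot all_order all_algebra.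
From mathcomp Require Import all_classical all_reals all_analysis.
From mathcomp Require Import measurable_realfun ring lra.

Import Order.TTheory GRing.Theory Num.Theory.
Import numFieldNormedType.Exports.

Local Open Scope classical_set_scope.
Local Open Scope ring_scope.

(** The inequality already fails in dimension one when c2 is too large. Take
    X = Z standard normal, so that the covariance norm is 1, and let both events
    be the half-line Z > t. The assumed inequality becomes
      P(Z > t) - P(Z > t - eps)^2 <= c1 exp(- c2 eps^2).
    To exponential order the left-hand side is
      exp(- t^2 / 2) - exp(- (t - eps)^2),
    and the first term dominates as soon as t < sqrt 2 (t - eps), that is,
    t > (2 + sqrt 2) eps. For t = sqrt 2 z eps with z > 1 + sqrt 2 fixed and eps
    large this forces exp(- z^2 eps^2) to be at most of the order of
    exp(- c2 eps^2), hence c2 <= z^2. Letting z decrease to 1 + sqrt 2 gives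
    c2 <= (1 + sqrt 2)^2 = 1 / (3 - 2 sqrt 2).

    Rough tail estimates suffice, since errors of order exp(O(eps)) are
    harmless: normal_tail_le and normal_tail_ge compare the density with
    explicit functions. The exponents are compared in sprinkling_exponent_le.
    That Z is a Gaussian vector amounts to the scaling of the normal law
    (normal_prob_scale), and the covariance is controlled by E[Z^2] <= 1
    (second_moment_le1), which is read off from the total masses of the centred
    normal laws of standard deviation slightly above 1. *)

Lemma measurable_EFin_normal_pdf (R : realType) (m s : R) (D : set R) :
  measurable_fun D (fun x : R => (normal_pdf m s x)%:E).
Proof.
by apply/measurable_EFinP/measurable_funTS; exact: measurable_normal_pdf.
Qed.

Lemma EFin_normal_pdf_ge0 (R : realType) (m s x : R) :
  (0 <= (normal_pdf m s x)%:E)%E.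
Proof. by rewrite lee_fin normal_pdf_ge0. Qed.

(** * Dilations of the standard normal law *)

(** For nonzero a this is Lebesgue measure again (dilated_lebesgueE). Written as
    a multiple of a pushforward, it turns the substitution y = a x under an
    integral over an arbitrary Borel set into the transfer formula for
    pushforwards. *)
Definition dilated_lebesgue (R : realType) (a : R) :
  {measure set (measurableTypeR R) -> \bar R}.
Proof.
refine (mscale `|a|%:nng%R (pushforward (@lebesgue_measure R)
  ( *%R a : measurableTypeR R -> measurableTypeR R))).
exact: mulrl_measurable.
Defined.

(** Lebesgue measure is determined by its values on half-open intervals, which a
    dilation maps to intervals (closed at the other end when a < 0). *)
Lemma dilated_lebesgueE (R : realType) (a : R) (A : set R) :
  a != 0 -> measurable A -> lebesgue_measure A = dilated_lebesgue R a A.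
Proof.
move=> a0; move: A; apply: lebesgue_measure_unique => // _ [[x y]] _ <-.
rewrite /dilated_lebesgue /= /mscale /= /pushforward.
have [agt0|alt0] := ltP 0 a.
  rewrite (_ : _ @^-1` _ = `]x / a, y / a]%classic); last first.
    apply/seteqP; split => z /=; rewrite !in_itv/= ltr_pdivrMr// ler_pdivlMr//;
    by rewrite ![z * a]mulrC.
  rewrite !lebesgue_measure_itv /= !lte_fin ltr_pM2r ?invr_gt0//.
  case: ifP => _; last by rewrite mule0.
  rewrite -!EFinB -EFinM gtr0_norm//; congr EFin.
  by field.
have {}alt0 : a < 0 by rewrite lt_neqAle a0.
rewrite (_ : _ @^-1` _ = `[y / a, x / a[%classic); last first.
  apply/seteqP; split => z /=; rewrite !in_itv/= ltr_ndivlMr// ler_ndivrMr//;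
  by rewrite ![z * a]mulrC andbC.
rewrite !lebesgue_measure_itv /= !lte_fin ltr_nM2r ?invr_lt0//.
case: ifP => _; last by rewrite mule0.
rewrite -!EFinB -EFinM ltr0_norm//; congr EFin.
by field.
Qed.

(** This gives the law of every nonzero linear form in a one-dimensional standard
    normal vector. The two densities correspond under y = a x, the factor |a| of
    the dilated Lebesgue measure cancelling the one in the peak of the wider
    density. *)
Lemma normal_prob_scale (R : realType) (a : R) (B : set R) :
  a != 0 -> measurable B ->
  normal_prob 0 1 ( *%R a @^-1` B) = normal_prob 0 `|a| B.
Proof.
move=> a0 mB.
have ma : measurable_fun [set: R] ( *%R a) by exact: mulrl_measurable.
have mpdf := @measurable_EFin_normal_pdf R 0 `|a|.
have pdf0 := @EFin_normal_pdf_ge0 R 0 `|a|.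
rewrite /normal_prob [RHS](eq_measure_integral (dilated_lebesgue R a));
  last first.
  by move=> A mA _; rewrite -dilated_lebesgueE.
rewrite ge0_integral_mscale//=; last exact: mpdf.
rewrite (ge0_integral_pushforward
  (phi := *%R a : measurableTypeR R -> measurableTypeR R))//=; last exact: mpdf.
rewrite -ge0_integralZl//=; last 2 first.
- by rewrite -[X in measurable X]setTI; exact: ma.
- by apply: measurable_funTS; apply: (measurableT_comp (mpdf setT)).
apply: eq_integral => x _ /=; rewrite -EFinM; congr EFin.
rewrite !normal_pdfE ?oner_eq0 ?normr_eq0// /normal_peak /normal_fun !subr0.
rewrite expr1n mul1r real_normK ?num_real//.
rewrite mulrA; congr (_ * expR _); last by field.
rewrite -mulrnAr sqrtrM ?sqr_ge0// sqrtr_sqr.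
by rewrite invfM mulrA divff ?normr_eq0// mul1r.
Qed.

(** * The second moment of the standard normal law *)

(** The normal density agrees almost everywhere with the Radon-Nikodym
    derivative, because both have the same integrals over Borel sets. *)
Lemma ge0_integral_normal_prob (R : realType) (m s : R) (f : R -> \bar R) :
  measurable_fun [set: R] f -> (forall x, (0 <= f x)%E) ->
  (\int[normal_prob m s]_x f x =
   \int[lebesgue_measure]_x (f x * (normal_pdf m s x)%:E))%E.
Proof.
move=> mf f0; pose dom := @normal_prob_dominates R m s.
rewrite -(Radon_Nikodym_SigmaFinite.change_of_variables dom)//.
have iRN := Radon_Nikodym_SigmaFinite.f_integrable dom.
have mpdf := @measurable_EFin_normal_pdf R m s setT.
apply: ae_eq_integral => //.
- by apply: emeasurable_funM => //; exact: measurable_int iRN.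
- exact: emeasurable_funM.
- apply: ae_eqe_mul2l; apply: integral_ae_eq => // E _ mE.
  by rewrite -Radon_Nikodym_SigmaFinite.f_integral.
Qed.

(** Multiplying the standard density by exp(x^2 d) merely widens it; this is what
    makes the exponential moments of Z^2 available without any integration. *)
Lemma normal_pdf_widen (R : realType) (s x : R) : 0 < s ->
  expR (x ^+ 2 * ((1 - s ^- 2) / 2)) * normal_pdf 0 1 x = s * normal_pdf 0 s x.
Proof.
move=> s0; have sn0 : s != 0 by rewrite gt_eqF.
rewrite !normal_pdfE ?oner_eq0// /normal_peak /normal_fun !subr0.
rewrite -[s ^+ 2 * pi *+ 2]mulrnAr (sqrtrM _ (sqr_ge0 s)) sqrtr_sqr gtr0_norm//.
rewrite expr1n mul1r mulrCA -expRD [in RHS]invfM -[s^-1 * _ * _]mulrA.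
rewrite (mulVKf sn0).
congr (_ * expR _).
by field.
Qed.

(** Integrate 1 + d x^2 <= exp(d x^2) against the standard normal law, with
    d = (1 - s^-2) / 2: by normal_pdf_widen the right-hand side has integral
    s. *)
Lemma second_moment_widen (R : realType) (s : R) : 1 < s ->
  (1 + ((1 - s ^- 2) / 2)%:E * \int[normal_prob 0 1]_x (x ^+ 2)%:E <= s%:E)%E.
Proof.
move=> s1; have s0 : 0 < s by rewrite (lt_trans ltr01).
have d0 : 0 <= (1 - s ^- 2) / 2.
  by rewrite divr_ge0// subr_ge0 invf_le1 ?exprn_gt0// exprn_ege1// ltW.
set d := (_ / 2) in d0 *.
have msq : measurable_fun [set: R] (fun x : R => (x ^+ 2)%:E).
  by apply/measurable_EFinP; exact: measurable_funX.
have sq0 (x : R) : (0 <= (x ^+ 2)%:E)%E by rewrite lee_fin sqr_ge0.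
rewrite -ge0_integralZl_EFin//.
rewrite -[X in (X + _)%E](probability_setT (normal_prob 0 1)).
rewrite -[X in (X + _)%E]mul1e.
rewrite -integral_cst// -ge0_integralD//; last 2 first.
- by move=> x _; rewrite mule_ge0.
- exact: measurable_funeM.
have -> : (s%:E = \int[lebesgue_measure]_x
    (expR (x ^+ 2 * d) * normal_pdf 0 1 x)%:E)%E.
  under eq_integral do rewrite normal_pdf_widen// EFinM.
  rewrite ge0_integralZl_EFin ?ltW//.
  - by rewrite integral_normal_pdf mule1.
  - by move=> x _; exact: EFin_normal_pdf_ge0.
  - exact: measurable_EFin_normal_pdf.
under [leRHS]eq_integral do rewrite EFinM.
rewrite -ge0_integral_normal_prob; last 2 first.
- apply/measurable_EFinP/measurableT_comp => //.
  by apply: measurable_funM => //; exact: measurable_funX.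
- by move=> x; rewrite lee_fin expR_ge0.
apply: ge0_le_integral => //.
- by move=> x _; rewrite adde_ge0// mule_ge0.
- by apply: emeasurable_funD => //; exact: measurable_funeM.
- apply/measurable_EFinP/measurableT_comp => //.
  by apply: measurable_funM => //; exact: measurable_funX.
- by move=> x _; rewrite -EFinM -EFinD lee_fin mulrC expR_ge1Dx.
Qed.

(** By second_moment_widen the second moment is at most 2 s^2 / (s + 1) for every
    s > 1, and this tends to 1 as s decreases to 1. *)
Lemma second_moment_le1 (R : realType) :
  (\int[normal_prob 0 1]_x ((x : R) ^+ 2)%:E <= 1)%E.
Proof.
have := @second_moment_widen R.
have : (0 <= \int[normal_prob 0 1]_x ((x : R) ^+ 2)%:E)%E.
  by apply: integral_ge0 => x _; rewrite lee_fin sqr_ge0.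
case: (\int[normal_prob 0 1]_x _)%E => [M| |] // M0 H; last first.
  (* s = 2 already excludes an infinite moment *)
  have := H 2 (ltr1n _ 2).
  by rewrite mulry gtr0_sg ?mul1e//; lra.
rewrite lee_fin; apply/ler_addgt0Pl => e e0.
(* s = 1 + e / 2 satisfies 2 s^2 / (s + 1) <= 1 + e *)
have s1 : 1 < 1 + e / 2 by lra.
have := H _ s1; rewrite -EFinM -EFinD lee_fin; set s := 1 + e / 2 in s1 *.
have -> : (1 - s ^- 2) / 2 = (s - 1) * ((s + 1) / (2 * s ^+ 2)).
  by field; rewrite gt_eqF//; lra.
rewrite -mulrA -lerBrDl -[leRHS]mulr1 ler_pM2l; last by lra.
rewrite mulrAC ler_pdivrMr ?mul1r; last by rewrite mulr_gt0// exprn_gt0//; lra.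
move=> h; have {h} : (s + 1) * M <= (s + 1) * (e + 1).
  by apply: (le_trans h); rewrite /s; nra.
by rewrite ler_pM2l//; lra.
Qed.

(** * Tails of the standard normal law *)

(** For x >= s >= 0 one has x^2 >= s^2 + (x - s)^2, so on the half-line the
    density is at most exp(- s^2 / 2) times the density of mean s, whose total
    mass is 1. *)
Lemma normal_tail_le (R : realType) (s : R) : 0 <= s ->
  (normal_prob 0 1 `]s, +oo[ <= (expR (- s ^+ 2 / 2))%:E)%E.
Proof.
move=> s0; rewrite -[leRHS]mule1 -(@integral_normal_pdf R s 1).
have mpdf m := @measurable_EFin_normal_pdf R m 1.
have pdf0 m := @EFin_normal_pdf_ge0 R m 1.
rewrite -ge0_integralZl_EFin ?expR_ge0// /normal_prob; last exact: mpdf.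
apply: (@le_trans _ _ (\int[lebesgue_measure]_(x in `]s, +oo[)
  ((expR (- s ^+ 2 / 2))%:E * (normal_pdf s 1 x)%:E))%E); last first.
  apply: ge0_subset_integral => //.
    by apply: measurable_funeM; exact: mpdf.
  by move=> x _; rewrite mule_ge0// lee_fin expR_ge0.
apply: ge0_le_integral => //.
- exact: mpdf.
- by apply: measurable_funeM; exact: mpdf.
move=> x /=; rewrite in_itv/= andbT => sx.
rewrite -EFinM lee_fin !normal_pdfE ?oner_eq0// mulrCA.
rewrite ler_wpM2l ?normal_peak_ge0//.
rewrite /normal_fun -expRD ler_expR subr0 expr1n; nra.
Qed.

(** The density decreases on the unit interval that follows t, so its integral
    there is at least its value at t + 1. *)
Lemma normal_tail_ge (R : realType) (t : R) : 0 <= t ->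
  ((normal_peak 1 * expR (- (t + 1) ^+ 2 / 2))%:E <= normal_prob 0 1 `]t, +oo[)%E.
Proof.
move=> t0.
have mpdf := @measurable_EFin_normal_pdf R 0 1.
have pdf0 := @EFin_normal_pdf_ge0 R 0 1.
apply: (@le_trans _ _ (\int[lebesgue_measure]_(x in `]t, (t + 1)%R])
   (normal_pdf 0 1 x)%:E)%E); last first.
  apply: ge0_subset_integral => //; first exact: mpdf.
  by move=> x /=; rewrite !in_itv/= andbT => /andP[].
set c := (_ * _)%R.
have <- : (\int[lebesgue_measure]_(x in `]t, (t + 1)%R]) (cst c%:E x) = c%:E)%E.
  rewrite integral_cst//= lebesgue_measure_itv/= lte_fin ltrDl ltr01 -EFinD.
  by rewrite [in RHS](_ : c = c * (t + 1 - t)) ?EFinM//; ring.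
apply: ge0_le_integral => //.
- by move=> x _; rewrite lee_fin mulr_ge0 ?expR_ge0 ?normal_peak_ge0.
- exact: mpdf.
move=> x /=; rewrite in_itv/= => /andP[tx xt].
rewrite lee_fin !normal_pdfE ?oner_eq0// ler_wpM2l ?normal_peak_ge0//.
rewrite /normal_fun ler_expR subr0 expr1n; nra.
Qed.

(** * The one-dimensional standard normal vector and half-line events *)

Definition identity_rv (R : realType) (P : probability (measurableTypeR R) R) :
  {RV P >-> R} :=
  HB.pack (idfun : measurableTypeR R -> R)
    (@isMeasurableFun.Build _ _ (measurableTypeR R) R idfun
       (@measurable_id _ _ setT)).

Definition standard_normal (R : realType) : probability (measurableTypeR R) R :=
  normal_prob 0 1.

Definition standard_normal_vector (R : realType) (i : 'I_1) :
  {RV (standard_normal R) >-> R} := identity_rv R (standard_normal R).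

Lemma standard_normal_vector_gaussian (R : realType) :
  gaussian_vector (standard_normal_vector R).
Proof.
move=> a; exists 0, `|a ord0|; split => // B mB; rewrite /gaussian_law normr_eq0.
rewrite (_ : [set w | _] = *%R (a ord0) @^-1` B); last first.
  by apply/seteqP; split => w /=; rewrite big_ord1.
have [->|a0] := eqVneq (a ord0) 0; last exact: normal_prob_scale.
rewrite diracE; have [B0|nB0] := boolP (0 \in B).
  rewrite (_ : _ @^-1` _ = setT) ?probability_setT//.
  by apply/seteqP; split => // w _ /=; rewrite mul0r; exact: set_mem.
rewrite (_ : _ @^-1` _ = set0) ?measure0//.
by apply/seteqP; split => // w /=; rewrite mul0r => /mem_set; rewrite (negbTE nB0).
Qed.

Lemma standard_normal_Lfun2 (R : realType) :
  (idfun : measurableTypeR R -> R) \in Lfun (standard_normal R) 2%:E.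
Proof.
rewrite inE; apply/andP; split; rewrite inE/=; first exact: measurable_id.
rewrite /finite_norm unlock poweR_lty//.
apply: le_lt_trans (ltry 1); apply: le_trans (second_moment_le1 R).
have normE (x : R) : (`|x%:E| `^ 2 = (x ^+ 2)%:E)%E.
  by rewrite abse_EFin poweR_EFin powR_mulrn// real_normK ?num_real.
rewrite le_eqVlt; apply/predU1P; left.
by apply: eq_integral => x _; exact: normE.
Qed.

Lemma standard_normal_variance_le1 (R : realType) (i j : 'I_1) :
  0 <= cov_kernel (standard_normal_vector R) i j <= 1.
Proof.
have L2 := standard_normal_Lfun2 R; rewrite /cov_kernel.
rewrite -[covariance _ _ _]/('V_(standard_normal R)[idfun]).
rewrite fine_ge0 ?variance_ge0//=.
rewrite -lee_fin fineK ?variance_fin_num// varianceE//.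
apply: le_trans (second_moment_le1 R).
by rewrite unlock; apply: geeDl; rewrite oppe_le0 sqre_ge0.
Qed.

(** The inequality is strict so that the event is open. *)
Definition half_line_event (R : realType) (t : R) : set 'rV[R]_1 :=
  [set x | t < x ord0 ord0].

Lemma borel_half_line_event (R : realType) (t : R) :
  borel_event (half_line_event R t).
Proof.
apply: sub_sigma_algebra.
rewrite /= -[half_line_event R t]/((fun x : 'rV[R]_1 => x ord0 ord0) @^-1`
  [set y | t < y]).
apply: open_comp; last exact: open_gt.
by move=> x _; exact: coord_continuous.
Qed.

Lemma increasing_half_line_event (R : realType) (t : R) :
  increasing_event (half_line_event R t).
Proof.
move=> x v tx v0; rewrite /half_line_event /= mxE.
by rewrite (lt_le_trans tx)// lerDl.
Qed.

Lemma half_line_event_supported (R : realType) (t : R) :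
  supported_on [set: 'I_1]%SET (half_line_event R t).
Proof. by move=> v v0 x; rewrite /half_line_event /= mxE v0 ?inE// addr0. Qed.

Lemma sup_norm_on_ord1 (R : realType) (K : 'I_1 -> 'I_1 -> R) :
  sup_norm_on K [set: 'I_1]%SET [set: 'I_1]%SET = `|K ord0 ord0|.
Proof.
rewrite /sup_norm_on.
have max1 (F : 'I_1 -> R) : (forall i, 0 <= F i) ->
    \big[Num.max/0]_(i in [set: 'I_1]%SET) F i = F ord0.
  move=> F0; rewrite (eq_bigl xpredT) => [|i]; last by rewrite inE.
  by rewrite big_ord_recl big_ord0; exact/max_idPl.
by rewrite !max1 // => i; rewrite max1.
Qed.

(** The bound increases with the covariance norm, so it may be replaced by its
    value at norm 1 as soon as the variance is at most 1. *)
Lemma sprinkling_bound_le (R : realType) (c1 c2 eps k : R) :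
  0 < c1 -> 0 < c2 -> 0 <= k <= 1 ->
  sprinkling_bound c1 c2 eps k <= c1 * expR (- (c2 * eps ^+ 2)).
Proof.
move=> c10 c20 /andP[k0 k1]; rewrite /sprinkling_bound.
case: eqP => [_|/eqP kn0]; first by rewrite mulr_ge0 ?expR_ge0 ?ltW.
have {kn0}k0 : 0 < k by rewrite lt_neqAle eq_sym kn0.
rewrite ler_pM2l// ler_expR lerN2 ler_pdivlMr// ler_piMr//.
by rewrite mulr_ge0 ?sqr_ge0 ?ltW.
Qed.

(** * Comparison of the exponents *)

Lemma exists_pos_quadratic_gt (R : realType) (d b M : R) : 0 < d ->
  exists2 e, 0 < e & M < d * e ^+ 2 - b * e.
Proof.
(* e >= 1 and d e - b > M, so the difference e (d e - b) exceeds M *)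
move=> d0; exists ((`|b| + `|M| + d + 1) / d).
  by rewrite divr_gt0//; have := normr_ge0 b; have := normr_ge0 M; lra.
set e := _ / d.
have e1 : 1 <= e.
  rewrite ler_pdivlMr// mul1r.
  by have := normr_ge0 b; have := normr_ge0 M; lra.
have -> : d * e ^+ 2 - b * e = e * (`|b| + `|M| + d + 1 - b).
  by rewrite /e; field; rewrite gt_eqF.
have := ler_norm b; have := ler_norm M; have := normr_ge0 M.
by set nb := `|b|; set nM := `|M| => *; nra.
Qed.

(** Here r is the square root of 2. If c2 > (1 + r)^2, choose z strictly between
    1 + r and sqrt c2 and put t = r z eps. Up to a factor exp(O(eps)) the
    left-hand side is then exp(- z^2 eps^2), whereas both exponents on the right,
    (r z - 1)^2 and c2, exceed z^2. This is absurd for large eps. *)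
Lemma sprinkling_exponent_le (R : realType) (c c1 c2 r : R) :
  0 < c -> 0 <= c1 -> 0 <= c2 -> 0 < r -> r ^+ 2 = 2 ->
  (forall t eps, 0 < eps -> eps <= t ->
    c * expR (- (t + 1) ^+ 2 / 2) <=
    expR (- (t - eps) ^+ 2) + c1 * expR (- (c2 * eps ^+ 2))) ->
  c2 <= (1 + r) ^+ 2.
Proof.
move=> c0 c10 c20 r0 r2 H; rewrite leNgt; apply/negP => c2r.
have r1 : 1 < r by nra.
pose q := Num.sqrt c2; have q0 : 0 <= q by exact: sqrtr_ge0.
have q2 : q ^+ 2 = c2 by rewrite sqr_sqrtr.
have rq : 1 + r < q by rewrite -(@ltr_pXn2r _ 2)// ?nnegrE ?q2//; lra.
pose z := (1 + r + q) / 2.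
have zr : 1 + r < z by rewrite /z; lra.
have zq : z < q by rewrite /z; lra.
have zc2 : 0 < c2 - z ^+ 2 by rewrite -q2; nra.
have zz : 0 < (r * z - 1) ^+ 2 - z ^+ 2.
  (* as r^2 = 2, this is z^2 - 2 r z + 1, positive beyond its root r + 1 *)
  rewrite (_ : _ - _ = (z - r) ^+ 2 - 1); last by ring: r2.
  nra.
(* d is the gap between z^2 and the smaller exponent on the right *)
pose d := Num.min (c2 - z ^+ 2) ((r * z - 1) ^+ 2 - z ^+ 2).
have d0 : 0 < d by rewrite lt_min zc2 zz.
(* 1 + M <= expR M beats the ratio M of the prefactors, and 2^-1 absorbs the
   constant term of (t + 1)^2 / 2 *)
pose M := (1 + c1) / c.
have [e e0 Me] := exists_pos_quadratic_gt R d (r * z) (M + 2^-1) d0.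
have le_e : e <= r * z * e by rewrite ler_peMl ?ltW//; nra.
have := H _ _ e0 le_e; rewrite leNgt => /negP; apply.
have expd k : d <= k - z ^+ 2 ->
    expR (- (k * e ^+ 2)) <= expR (- ((z ^+ 2 + d) * e ^+ 2)).
  by move=> dk; rewrite ler_expR lerN2 ler_wpM2r ?sqr_ge0//; lra.
have dl : d <= c2 - z ^+ 2 by rewrite ge_min lexx.
have dr : d <= (r * z - 1) ^+ 2 - z ^+ 2 by rewrite ge_min lexx orbT.
apply: (@le_lt_trans _ _ ((1 + c1) * expR (- ((z ^+ 2 + d) * e ^+ 2)))).
  rewrite mulrDl mul1r; apply: lerD; last by apply: ler_wpM2l => //; exact: expd.
  have -> : (r * z * e - e) ^+ 2 = (r * z - 1) ^+ 2 * e ^+ 2 by ring.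
  exact: expd.
have -> : - (r * z * e + 1) ^+ 2 / 2 =
    - ((z ^+ 2 + d) * e ^+ 2) + (d * e ^+ 2 - r * z * e - 2^-1).
  by field: r2.
rewrite expRD [ltRHS]mulrCA [ltLHS]mulrC ltr_pM2l ?expR_gt0//.
rewrite -ltr_pdivrMl// mulrC -/M.
apply: (@lt_le_trans _ _ (1 + M)); first by rewrite ltrDr.
by apply: (le_trans _ (expR_ge1Dx _)); lra.
Qed.

(** * The bound on the constant *)

Theorem proposition1p7 (R : realType) (c1 c2 : R) (hc1 : 0 < c1) (hc2 : 0 < c2)
  (H : forall (n : nat), (1 <= n)%N ->
    forall (d : measure_display) (T : measurableType d) (P : probability T R)
      (X : 'I_n -> {RV P >-> R}), gaussian_vector X ->
    forall (I1 I2 : {set 'I_n}) (A1 A2 : set 'rV[R]_n),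
      borel_event A1 -> increasing_event A1 -> supported_on I1 A1 ->
      borel_event A2 -> increasing_event A2 -> supported_on I2 A2 ->
    forall eps : R, 0 < eps ->
      (P [set w | (A1 `&` A2) (random_vector X w)]
       - P [set w | A1 (random_vector X w + const_mx eps)%R]
         * P [set w | A2 (random_vector X w + const_mx eps)%R]
       <= (sprinkling_bound c1 c2 eps (sup_norm_on (cov_kernel X) I1 I2))%:E)%E) :
  c2 <= 1 / (3 - 2 * Num.sqrt 2).
Proof.
pose r : R := Num.sqrt 2.
have r0 : 0 < r by rewrite sqrtr_gt0.
have r2 : r ^+ 2 = 2 by rewrite sqr_sqrtr.
have -> : 1 / (3 - 2 * Num.sqrt 2) = (1 + r) ^+ 2.
  rewrite -/r; have r_lt : 3 - 2 * r != 0 by rewrite gt_eqF//; nra.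
  apply: (mulIf r_lt); rewrite mul1r mulVf//; ring: r2.
apply: (sprinkling_exponent_le R (normal_peak 1) c1) => //; try exact: ltW.
  by rewrite normal_peak_gt0 ?oner_eq0.
move=> t e e0 et.
have := H 1%N isT _ _ _ _ (standard_normal_vector_gaussian R)
  [set: 'I_1]%SET [set: 'I_1]%SET _ _
  (borel_half_line_event R t) (increasing_half_line_event R t)
  (half_line_event_supported R t)
  (borel_half_line_event R t) (increasing_half_line_event R t)
  (half_line_event_supported R t) _ e0.
rewrite setIid sup_norm_on_ord1.
have /andP[K0 K1] := standard_normal_variance_le1 R ord0 ord0.
have eventE a : [set w | half_line_event R t
    (random_vector (standard_normal_vector R) w + const_mx a)] =
    `]t - a, +oo[%classic.
  apply/seteqP; split => w /=;
  by rewrite /half_line_event /= !mxE in_itv/= andbT ltrBlDr.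
have event0 : [set w | half_line_event R t
    (random_vector (standard_normal_vector R) w)] = `]t, +oo[%classic.
  apply/seteqP; split => w /=;
  by rewrite /half_line_event /= !mxE in_itv/= andbT.
rewrite event0 !eventE => {}H.
rewrite -lee_fin EFinD -leeBlDl//.
have K01 : 0 <= `|cov_kernel (standard_normal_vector R) ord0 ord0| <= 1.
  by rewrite ger0_norm ?K0.
have bound := sprinkling_bound_le _ _ _ e _ hc1 hc2 K01; rewrite -lee_fin in bound.
apply: le_trans bound; apply: le_trans H.
apply: leeB; first by apply: normal_tail_ge; lra.
have te : 0 <= t - e by lra.
have -> : - (t - e) ^+ 2 = - (t - e) ^+ 2 / 2 + - (t - e) ^+ 2 / 2 by field.
by rewrite expRD EFinM; apply: lee_pmul => //; exact: normal_tail_le.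
Qed.
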